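(* For steps, $m_k^*\le 2k-1$. That is, for every positive integer $k$, every finite family $\mathcal{F}$ of bottomless rectangles that contains no towers and no nested sets (no two members of $\mathcal{F}$ form a $2$-tower or a $2$-nested set) can be $k$-coloured so that every point of $\mathbb{R}^2$ covered by at least $2k-1$ rectangles of $\mathcal{F}$ is covered by rectangles of all $k$ colours.
   Context: A (closed) bottomless rectangle is a subset of $\mathbb{R}^2$ of the form $\{(x,y): l\le x\le r,\ y\le t\}$, denoted by its parameters $(l,r,t)$; $l$ is its left-coordinate, $r$ its right-coordinate and $t$ its height. Two bottomless rectangles $R_1=(l_1,r_1,t_1)$, $R_2=(l_2,r_2,t_2)$ form a ($2$-)tower if $l_1<l_2$, $r_2<r_1$ and $t_1<t_2$, and form a ($2$-)nested set if $l_1<l_2$, $r_2<r_1$ and $t_2<t_1$. ''Steps'' refers to the case of families containing no towers or nested sets. For a class of families, $m_k^*$ is the smallest number $m$ such that every finite family in the class can be $k$-coloured so that every point covered by at least $m$ members of the family is covered by members of all $k$ colours. *)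

(* Defs.v *)
From mathcomp Require Import all_boot all_order all_algebra.
From mathcomp Require Import reals.

Set Implicit Arguments.
Unset Strict Implicit.
Unset Printing Implicit Defensive.

Import Order.TTheory GRing.Theory Num.Theory.
Local Open Scope ring_scope.

(* No relation between [rl] and [rr] is imposed: when [rr < rl] the rectangle
   is the empty set, which is harmless since it covers no point. *)
Record rect (R : realType) : Type := Rect { rl : R; rr : R; rt : R }.

Definition covers (R : realType) (A : rect R) (p : R * R) : bool :=
  (rl A <= p.1 <= rr A) && (p.2 <= rt A).

Definition tower (R : realType) (A B : rect R) : bool :=
  [&& rl A < rl B, rr B < rr A & rt A < rt B].

Definition nested (R : realType) (A B : rect R) : bool :=
  [&& rl A < rl B, rr B < rr A & rt B < rt A].

(* A finite family is indexed by a finType, so a rectangle may be repeated;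
   a finite set of rectangles is the case of an injective [F].  Quantifying
   over ordered pairs of indices forbids both orders, and the diagonal is
   vacuous because [tower] and [nested] are irreflexive. *)
Definition family_class (R : realType) : Type :=
  forall I : finType, (I -> rect R) -> Prop.

Definition steps (R : realType) : family_class R :=
  fun I F => forall i j : I, ~~ tower (F i) (F j) /\ ~~ nested (F i) (F j).

Definition depth (R : realType) (I : finType) (F : I -> rect R) (p : R * R)
  : nat := #|[set i | covers (F i) p]|.

Definition polychromatic (R : realType) (I : finType) (F : I -> rect R)
    (k m : nat) (c : I -> 'I_k) : Prop :=
  forall p : R * R, (m <= depth F p)%N ->
    forall a : 'I_k, exists i : I, covers (F i) p /\ c i = a.

Definition admissible (R : realType) (C : family_class R) (k m : nat) : Prop :=
  forall (I : finType) (F : I -> rect R), C I F ->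
    exists c : I -> 'I_k, polychromatic F m c.

Definition is_mk_star (R : realType) (C : family_class R) (k m : nat) : Prop :=
  admissible C k m /\ forall m' : nat, admissible C k m' -> (m <= m')%N.

(* Main.v *)
Require Import Defs.
From mathcomp Require Import all_boot all_order all_algebra.
From mathcomp Require Import reals.
From mathcomp Require Import boolp lra zify.

(** Rank the rectangles by height, breaking ties by width and then by an
    enumeration.  As there are no towers, of two rectangles, one lying strictly
    inside the other horizontally, the outer one always ranks higher.  The
    rectangles covering a point (x, y) are an initial segment, from the top of
    this ranking, of the column of those met by the vertical line at x.  So it
    is enough to colour the rectangles so that the 2k-1 highest members of each
    column with that many members show all k colours.

    This is done one colour at a time ([colour_top_segments]).  By
    [hitting_set], for each m > 0 some set S of rectangles meets each segment
    of the m highest members of a column, and in at most two elements.  Giving the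
    members of S one colour and deleting them leaves at least m - 2 members of
    the segment, among which are the m - 2 highest of what remains in the
    column; the induction goes from 2k+1 to 2k-1 and ends with segments of
    size 1, for which one colour is enough.

    For S take an inclusion-minimal hitting set among the rectangles of the
    upper envelope, those that are highest in some column.  No envelope member
    is strictly inside another, so the envelope is ordered from left to right.
    If a segment A at x contained s1, s2, s3 of S in this order, then by
    minimality some segment B at some x' would meet S in s2 only.  When x' lies
    to the left of x, every member of B outside A ranks above s1, avoids the
    column where s1 is highest and avoids x, so it is strictly inside s1 and
    ranks above it, which is excluded ([segment_slide]).  Hence B is contained
    in A, and they have the same size, but s1 is in A and not in B.  When x'
    lies to the right, the mirror image of this argument applies to s3. *)

Set Implicit Arguments.
Unset Strict Implicit.
Unset Printing Implicit Defensive.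

Import Order.TTheory GRing.Theory Num.Theory.
Local Open Scope ring_scope.

(** * Columns of ranked intervals *)

Section Columns.

Context {R : realType} {I : finType} {d : Order.disp_t} {K : orderType d}.
Implicit Types (l r : I -> R) (h : I -> K) (V A B E S : {set I}).

Definition column l r V (x : R) : {set I} := [set i in V | l i <= x <= r i].

Definition top_segment l r h V (x : R) E : Prop :=
  E \subset column l r V x /\
  forall i j, i \in E -> j \in column l r V x -> (h i < h j)%O -> j \in E.

Definition on_envelope l r h V (u : I) : Prop :=
  exists x, u \in column l r V x /\
    forall j, j \in column l r V x -> (h j <= h u)%O.

(** This is how the absence of towers enters: for [h] the height with ties
    broken by width, it says that there are none. *)
Definition outer_higher l r h : Prop :=
  forall i j, l i < l j -> r j < r i -> (h j < h i)%O.

Lemma top_segment_trim l r h V x E m :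
  injective h -> top_segment l r h V x E -> (m <= #|E|)%N ->
  exists E', [/\ E' \subset E, top_segment l r h V x E' & #|E'| = m].
Proof.
move=> hinj; move: {2}(#|E| - m)%N (erefl (#|E| - m)%N) => n.
elim: n E => [|n IHn] E En segE leE.
  by exists E; split=> //; apply/eqP; rewrite eqn_leq leE -subn_eq0 En eqxx.
have [i0 i0E] : exists i, i \in E.
  by apply/set0Pn; rewrite -card_gt0; apply: leq_ltn_trans (leq0n m) _;
     rewrite -subn_gt0 En.
have [/= e eE emin] := arg_minP h i0E.
have cE : #|E :\ e| = #|E|.-1 by rewrite (cardsD1 e E) (eE : e \in E).
have [| | |E' [sub seg c]] := IHn (E :\ e).
- by move: En; lia.
- split; first exact: subset_trans (subsetDl _ _) segE.1.
  move=> i j /setD1P[_ iE] jc hij; rewrite in_setD1.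
  rewrite (segE.2 _ _ iE jc hij) andbT.
  by apply: contraTneq hij => ->; rewrite -leNgt; apply: emin.
- by move: En; lia.
by exists E'; split=> //; apply: subset_trans sub (subsetDl _ _).
Qed.

Lemma top_segment_setD l r h V x E S :
  top_segment l r h V x E -> top_segment l r h (V :\: S) x (E :\: S).
Proof.
move=> [/subsetP sub up]; split.
  apply/subsetP => i; rewrite !inE => /andP[-> /sub].
  by rewrite !inE.
move=> i j; rewrite !inE => /andP[iS iE] /andP[/andP[jS jV] jx] hij.
by rewrite jS (up i j) // !inE jV.
Qed.

Lemma mem_top_segment_ltn l r h V x E i j :
  injective h -> top_segment l r h V x E -> i \in column l r V x ->
  i \notin E -> j \in E -> (h i < h j)%O.
Proof.
move=> hinj [_ up] ic iE jE; case: ltgtP => // [hji | /hinj ij].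
  by move: iE; rewrite (up j i).
by move: iE; rewrite ij jE.
Qed.

(** * Spreading along the upper envelope *)

(** An interval strictly around an envelope member would be higher than it
    throughout its extent. *)
Lemma envelope_not_inside l r h V u v :
  outer_higher l r h -> u \in V -> on_envelope l r h V v ->
  ~~ ((l u < l v) && (r v < r u)).
Proof.
move=> out uV [x [vx vtop]]; apply/negP => /andP[ltl ltr].
have := vtop u; rewrite leNgt out // => /implyP; rewrite implybF => /negP[].
move: vx; rewrite !inE uV /= => /andP[_ /andP[lx xr]].
by apply/andP; split; lra.
Qed.

(** The sums [l + r], that is the midpoints, sort both the left and the right
    ends of the envelope. *)
Lemma envelope_sorted l r h V u v :
  outer_higher l r h -> on_envelope l r h V u -> on_envelope l r h V v ->
  l u + r u <= l v + r v -> l u <= l v /\ r u <= r v.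
Proof.
move=> out eu ev le.
have uV : u \in V by case: eu => x [+ _]; rewrite !inE => /andP[].
have vV : v \in V by case: ev => x [+ _]; rewrite !inE => /andP[].
have := envelope_not_inside out uV ev; have := envelope_not_inside out vV eu.
by rewrite !negb_and -!leNgt => /orP[] ? /orP[] ?; split; lra.
Qed.

(** An element [b] of [B] outside [A] would rank above [s1], miss both the
    column [x1] where [s1] is highest and the column [x], and still meet
    [x'], which lies between the two; so [s1] would reach beyond [b] on both
    sides. *)
Lemma segment_slide l r h V A B x x' s1 s2 :
  injective h -> outer_higher l r h -> on_envelope l r h V s1 ->
  top_segment l r h V x A -> top_segment l r h V x' B -> x' <= x ->
  s1 \in A -> s2 \in B -> s1 \notin B -> l s1 <= l s2 -> r s1 <= r s2 ->
  B \subset A.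
Proof.
move=> hinj out [x1 [s1x1 s1top]] segA segB lex s1A s2B s1B lel ler.
have inA i : i \in A -> i \in column l r V x by apply/subsetP/segA.1.
have inB i : i \in B -> i \in column l r V x' by apply/subsetP/segB.1.
have s1x' : s1 \in column l r V x'.
  move: (inA _ s1A) (inB _ s2B); rewrite !inE.
  by move=> /andP[-> /andP[? ?]] /andP[_ /andP[? ?]]; apply/andP; split; lra.
have above b : b \in B -> (h s1 < h b)%O by apply: mem_top_segment_ltn segB _ _.
have not_x1 b : b \in B -> b \notin column l r V x1.
  by move=> /above; rewrite ltNge; apply/contra/s1top.
have x1x' : x1 < x'.
  move: (inB _ s2B) (not_x1 _ s2B) s1x1; rewrite !inE.
  move=> /andP[-> /andP[? ?]]; rewrite /= negb_and -!ltNge.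
  by move=> /orP[] ? /andP[_ /andP[? ?]]; lra.
apply/subsetP => b bB; apply/contraT => bA.
have bx : b \notin column l r V x.
  by apply: contra bA => bx; apply: segA.2 s1A bx (above _ bB).
have := out s1 b; rewrite ltNge (ltW (above _ bB)) => /= H.
move: (inB _ bB) (not_x1 _ bB) bx s1x1 (inA _ s1A); rewrite !inE.
move=> /andP[-> /andP[? ?]]; rewrite /= !negb_and -!ltNge.
by move=> /orP[] ? /orP[] ? /andP[_ /andP[? ?]] /andP[_ /andP[? ?]];
   apply: H; lra.
Qed.

(** Reflection in the vertical axis keeps columns and ranks, so the case where
    [x'] lies to the right of [x] follows from [segment_slide]. *)
Lemma column_opp l r V x :
  column (fun i => - r i) (fun i => - l i) V (- x) = column l r V x.
Proof. by apply/setP => i; rewrite !inE !lerN2 (andbC (x <= r i)). Qed.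

Lemma top_segment_opp l r h V x E :
  top_segment l r h V x E ->
  top_segment (fun i => - r i) (fun i => - l i) h V (- x) E.
Proof. by rewrite /top_segment column_opp. Qed.

Lemma on_envelope_opp l r h V u :
  on_envelope l r h V u ->
  on_envelope (fun i => - r i) (fun i => - l i) h V u.
Proof. by move=> [x H]; exists (- x); rewrite column_opp. Qed.

Lemma outer_higher_opp l r h :
  outer_higher l r h -> outer_higher (fun i => - r i) (fun i => - l i) h.
Proof. by move=> out i j; rewrite !ltrN2 => ? ?; apply: out. Qed.

Lemma segment_slide_opp l r h V A B x x' s3 s2 :
  injective h -> outer_higher l r h -> on_envelope l r h V s3 ->
  top_segment l r h V x A -> top_segment l r h V x' B -> x <= x' ->
  s3 \in A -> s2 \in B -> s3 \notin B -> l s2 <= l s3 -> r s2 <= r s3 ->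
  B \subset A.
Proof.
move=> hinj /outer_higher_opp out /on_envelope_opp env /top_segment_opp segA.
move=> /top_segment_opp segB lex s3A s2B s3B lel ler.
by apply: segment_slide hinj out env segA segB _ s3A s2B s3B _ _;
   rewrite lerN2.
Qed.

(** * Colouring *)

Lemma card_gt2_sorted (f : I -> R) (T : {set I}) :
  (2 < #|T|)%N ->
  exists s1 s2 s3, [/\ s1 \in T, s2 \in T, s3 \in T, s1 != s2 & s3 != s2] /\
    f s1 <= f s2 <= f s3.
Proof.
move=> T3; have [i0 i0T] : exists i, i \in T.
  by apply/set0Pn; rewrite -card_gt0; apply: leq_ltn_trans T3.
have [/= s1 s1T min] := arg_minP f i0T.
have [/= s3 s3T max] := arg_maxP f i0T.
have /subsetPn[s2 s2T] : ~~ (T \subset [set s1; s3]).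
  apply: contraL T3 => /subset_leq_card; rewrite -leqNgt => /leq_trans; apply.
  by rewrite cards2; case: (_ != _).
rewrite !inE negb_or => /andP[n1 n3]; exists s1, s2, s3.
by split; [split=> //; rewrite eq_sym | rewrite min // max].
Qed.

Lemma hitting_set l r h V m :
  injective h -> outer_higher l r h -> (0 < m)%N ->
  exists S : {set I}, S \subset V /\
    forall x E, top_segment l r h V x E -> #|E| = m ->
      (0 < #|E :&: S| <= 2)%N.
Proof.
move=> hinj out m0.
pose hits (S : {set I}) := forall x E, top_segment l r h V x E -> #|E| = m ->
  exists2 i, i \in E & i \in S.
pose U := [set u in V | `[< on_envelope l r h V u >]].
have U_hits : hits U.
  move=> x E segE cE.
  have [i0 i0E] : exists i, i \in E by apply/set0Pn; rewrite -card_gt0 cE.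
  have [/= e eE emax] := arg_maxP h i0E.
  have ex : e \in column l r V x := subsetP segE.1 _ eE.
  exists e => //; rewrite inE; apply/andP; split.
    by move: ex; rewrite inE => /andP[].
  apply/asboolP; exists x; split=> // j jx; rewrite leNgt; apply/negP => lt.
  by have := emax j (segE.2 _ _ eE jx lt); rewrite leNgt lt.
have [|S /minsetP[/asboolP S_hits S_min] SU] :=
    @minset_exists _ (fun S : {set I} => `[< hits S >]) U.
  exact/asboolP.
have env u : u \in S -> on_envelope l r h V u.
  by move=> /(subsetP SU); rewrite inE => /andP[_ /asboolP].
exists S; split.
  by apply: subset_trans SU _; apply/subsetP => u; rewrite inE => /andP[].
move=> x A segA cA; apply/andP; split.
  have [i iA iS] := S_hits x A segA cA.
  by rewrite card_gt0; apply/set0Pn; exists i; rewrite inE iA.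
rewrite leqNgt; apply/negP => /(card_gt2_sorted (fun i => l i + r i)).
move=> [s1 [s2 [s3 [[]]]]]; rewrite !inE.
move=> /andP[s1A s1S] /andP[s2A s2S] /andP[s3A s3S] n12 n32 /andP[le12 le23].
(* Without [s2] the set [S] no longer hits: some segment meets it only there. *)
have [x' [B [segB cB only]]] : exists x' B, [/\ top_segment l r h V x' B,
    #|B| = m & forall i, i \in B -> i \in S -> i = s2].
  apply: contrapT => none; have : S :\ s2 = S.
    apply: S_min; last exact: subsetDl.
    apply/asboolP => x' B segB cB; apply: contrapT => none'.
    apply: none; exists x', B; split=> // i iB iS.
    by apply: contrapT => /eqP ni; apply: none'; exists i; rewrite // !inE ni.
  by move=> /setP/(_ s2); rewrite !inE eqxx s2S.
have s2B : s2 \in B by have [i iB iS] := S_hits x' B segB cB; rewrite -(only i).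
have s1B : s1 \notin B by apply: contra n12 => /only->.
have s3B : s3 \notin B by apply: contra n32 => /only->.
have BA : B \subset A.
  have [lex|/ltW lex] := lerP x' x.
    have [] := envelope_sorted out (env _ s1S) (env _ s2S) le12.
    exact: segment_slide (env _ s1S) segA segB lex s1A s2B s1B.
  have [] := envelope_sorted out (env _ s2S) (env _ s3S) le23.
  exact: segment_slide_opp (env _ s3S) segA segB lex s3A s2B s3B.
have /eqP eBA : B == A by rewrite eqEcard BA cA cB leqnn.
by move: s1B; rewrite eBA s1A.
Qed.

Lemma colour_top_segments l r h V k :
  injective h -> outer_higher l r h ->
  exists c : I -> nat, forall x E, top_segment l r h V x E ->
    (2 * k - 1 <= #|E|)%N ->
    forall a, (a < k)%N -> exists2 i, i \in E & c i = a.
Proof.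
move=> hinj out; elim: k V => [|[|k] IHk] V; first by exists (fun=> 0%N).
  exists (fun=> 0%N) => x E segE E1 [|//] _.
  by have /card_gt0P[i iE] := E1; exists i.
have [S [_ hitS]] := hitting_set V hinj out (isT : (0 < (2 * k).+3)%N).
have [c cP] := IHk (V :\: S).
exists (fun i => if i \in S then k.+1 else c i) => x E segE E1 a ak.
have [|E' [E'E segE' cE']] := top_segment_trim (m := (2 * k).+3) hinj segE.
  by move: E1; lia.
have /andP[S0 S2] := hitS _ _ segE' cE'.
have [->|na] := eqVneq a k.+1.
  have /card_gt0P[i] := S0; rewrite inE => /andP[iE' iS].
  by exists i; rewrite ?iS ?(subsetP E'E).
have [||i] := cP x (E' :\: S) (top_segment_setD S segE') _ a.
- by have := cardsID S E'; lia.
- by move: ak na; lia.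
rewrite inE => /andP[/negPf niS iE'] ci.
by exists i; rewrite ?niS ?(subsetP E'E).
Qed.

End Columns.

(** * Rectangles *)

Lemma tower_free_polychromatic (R : realType) (k : nat) (I : finType)
    (F : I -> rect R) :
  (0 < k)%N -> (forall i j, ~~ tower (F i) (F j)) ->
  exists c : I -> 'I_k, polychromatic F (2 * k - 1) c.
Proof.
case: k => // k _ notower.
pose K : orderType _ := (R *l (R *l 'I_#|I|))%type.
pose h i : K := (rt (F i), (rr (F i) - rl (F i), enum_rank i)).
have hinj : injective h by move=> i j [_ _ /enum_rank_inj].
have h_rt i j : (h i <= h j)%O -> rt (F i) <= rt (F j).
  by rewrite Order.ProdLexiOrder.lexi_pair => /andP[].
have out : outer_higher (fun i => rl (F i)) (fun i => rr (F i)) h.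
  move=> i j ltl ltr; have := notower i j; rewrite /tower ltl ltr /= -leNgt.
  move=> ji; rewrite !Order.ProdLexiOrder.ltxi_pair ji /=.
  apply/implyP => _; have lt : rr (F j) - rl (F j) < rr (F i) - rl (F i) by lra.
  by rewrite (ltW lt) leNgt lt.
have [c cP] := colour_top_segments [set: I] k.+1 hinj out.
exists (fun i => inord (c i)) => p deep a.
have [|i +] := cP p.1 [set i | covers (F i) p] _ deep a (ltn_ord a).
  split; first by apply/subsetP => i; rewrite !inE => /andP[].
  move=> i j; rewrite !inE /covers => /andP[_ pi] /= -> /ltW/h_rt.
  exact: le_trans pi.
by rewrite inE => cov ci; exists i; rewrite ci inord_val.
Qed.

Theorem proposition2p5 (R : realType) (k : nat) (hk : (0 < k)%N) :
  (exists m : nat, is_mk_star (@steps R) k m /\ (m <= 2 * k - 1)%N) /\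
  (forall (I : finType) (F : I -> rect R), steps F ->
     exists c : I -> 'I_k,
       forall p : R * R, (2 * k - 1 <= depth F p)%N ->
         forall a : 'I_k, exists i : I, covers (F i) p /\ c i = a).
Proof.
have adm : admissible (@steps R) k (2 * k - 1).
  move=> I F stepsF; apply: tower_free_polychromatic hk _ => i j.
  by case: (stepsF i j).
split; last exact: adm.
have ex : exists m, `[< admissible (@steps R) k m >].
  by exists (2 * k - 1)%N; apply/asboolP.
exists (ex_minn ex); case: ex_minnP => m /asboolP mP mmin.
by split; [split=> // m' /asboolP/mmin | apply: mmin; apply/asboolP].
Qed.
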